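(* Let $k$ be a constant. The query complexity of finding a local minimum of a function $f:[n]\to\mathbb{R}$ on the one-dimensional grid $[n]$ with at most $k$ rounds of queries is $\Theta(n^{1/k})$, for both deterministic and randomized algorithms.
   Context: $[n]=\{1,\dots,n\}$ with $i,j$ adjacent iff $|i-j|=1$. A local minimum is a point $i$ with $f(i)\le f(j)$ for all neighbours $j$. The algorithm has oracle access to $f$. In a $k$-round algorithm, each round's set of queries depends only on answers from earlier rounds (and random coins, if randomized); after round $k$ it outputs a solution. Deterministic query complexity: worst-case total number of queries to always succeed; randomized: worst-case expected number of queries of an algorithm that succeeds with probability at least $2/3$ on every input. Asymptotics are as $n\to\infty$. *)

(* Defs.v *)
From HB Require Import structures.
From mathcomp Require Import all_boot all_order all_algebra.
From mathcomp Require Import all_classical all_reals all_analysis.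

Set Implicit Arguments.
Unset Strict Implicit.
Unset Printing Implicit Defensive.

Import Order.TTheory GRing.Theory Num.Theory.
Import numFieldNormedType.Exports.
Local Open Scope classical_set_scope.
Local Open Scope ring_scope.

(* The grid [n] is 'I_n, i.e. its points are numbered 0, ..., n-1. *)
Definition adjacent (n : nat) (i j : 'I_n) : bool :=
  (i.+1 == j :> nat) || (j.+1 == i :> nat).

Definition local_min (R : realType) (n : nat) (f : 'I_n -> R) (i : 'I_n) : Prop :=
  forall j : 'I_n, adjacent i j -> f i <= f j.

(* A deterministic algorithm with at most k rounds is a decision tree of
   depth at most k.  The continuation of a round only receives the values of f
   on the set Q queried in that round, so later queries and the output depend
   on f through the answers already obtained and nothing else. *)
Inductive algorithm (R : realType) (n : nat) : nat -> Type :=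
| Output (k : nat) (i : 'I_n) : algorithm R n k
| Round (k : nat) (Q : {set 'I_n})
    (next : ({i : 'I_n | i \in Q} -> R) -> algorithm R n k) :
    algorithm R n k.+1.

Fixpoint output (R : realType) (n k : nat) (A : algorithm R n k)
    (f : 'I_n -> R) : 'I_n :=
  match A with
  | Output _ i => i
  | Round _ _ next => output (next (fun i => f (val i))) f
  end.

Fixpoint queries (R : realType) (n k : nat) (A : algorithm R n k)
    (f : 'I_n -> R) : nat :=
  match A with
  | Output _ _ => 0%N
  | Round _ Q next => (#|Q| + queries (next (fun i => f (val i))) f)%N
  end.

Definition det_correct (R : realType) (n k : nat) (A : algorithm R n k) : Prop :=
  forall f : 'I_n -> R, local_min f (output A f).

Definition det_cost (R : realType) (n k : nat) (A : algorithm R n k) : \bar R :=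
  ereal_sup [set ((queries A f)%:R : R)%:E | f in [set: 'I_n -> R]].

(* All coins are drawn at the start, from an arbitrary probability space; once
   they are fixed the algorithm is deterministic.  The last two fields say that
   on each input the output and the number of queries are (discrete) random
   variables. *)
Record rand_algorithm (R : realType) (n k : nat) : Type := RandAlgorithm {
  coin_display : measure_display;
  coins : measurableType coin_display;
  coin_law : probability coins R;
  run : coins -> algorithm R n k;
  measurable_output : forall (f : 'I_n -> R) (i : 'I_n),
    measurable [set w | output (run w) f = i];
  measurable_queries : forall (f : 'I_n -> R) (q : nat),
    measurable [set w | queries (run w) f = q]
}.
Arguments run {R n k} r _.

Definition rand_correct (R : realType) (n k : nat) (A : rand_algorithm R n k) : Prop :=
  forall f : 'I_n -> R,
    ((2 / 3 : R)%:E <= coin_law A [set w | local_min f (output (run A w) f)])%E.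

Definition rand_cost (R : realType) (n k : nat) (A : rand_algorithm R n k) : \bar R :=
  ereal_sup [set ('E_(coin_law A)[fun w => (queries (run A w) f)%:R])%E
            | f in [set: 'I_n -> R]].

(* [fine] sends infinite values to 0, but the infima below are finite as soon
   as 0 < n and 0 < k: querying the whole grid in one round is correct. *)
Definition det_query_complexity (R : realType) (k n : nat) : R :=
  fine (ereal_inf [set c : \bar R |
    exists2 A : algorithm R n k, det_correct A & c = det_cost A]).

Definition rand_query_complexity (R : realType) (k n : nat) : R :=
  fine (ereal_inf [set c : \bar R |
    exists2 A : rand_algorithm R n k, rand_correct A & c = rand_cost A]).

(* Main.v *)
(* Upper bound: with m^k >= n, round k - j queries, around the current best point
   p, the points congruent to p modulo m^j at distance less than m^(j+1), and
   moves p to the lowest of them.  The invariant is f p <= f (p +- m^j); after the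
   last round m^j = 1.  Each round costs at most 2m queries.

   Lower bound: the function [valley x] has x as its only local minimum, and a
   query at i only tells whether i < x, i = x or i > x.  Take x uniform.  By
   induction on k, for every scale M >= 1/2 and every set C of candidates, a
   deterministic k-round algorithm finds x for at most (2M)^k + T / M of the x in
   C, where T is the total number of queries it makes over C.  Being linear in T,
   this bound can be averaged over the coins; M = n^(1/k) / 4 then forces an
   expected cost of at least M / 6. *)

Require Import Defs.
From mathcomp Require Import all_boot all_order all_algebra.
From mathcomp Require Import all_classical all_reals all_analysis.
From mathcomp Require Import measurable_realfun.
From mathcomp Require Import zify ring lra.

Import Order.TTheory GRing.Theory Num.Theory.
Import numFieldNormedType.Exports.
Local Open Scope classical_set_scope.
Local Open Scope ring_scope.

(** * Functions with one hidden local minimum *)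

(** On each side of [x] the values are positive, do not depend on [x], and decrease strictly towards
    [x], so an answer off [x] reveals only the side. *)
Definition valley (R : realType) (n : nat) (x i : 'I_n) : R :=
  if (i < x)%N then (n - i)%:R else if i == x then 0 else i%:R.

Lemma local_min_valley (R : realType) (n : nat) (x i : 'I_n) :
  local_min (valley R n x) i <-> i = x.
Proof.
split=> [imin|-> j _]; last first.
  by rewrite {1}/valley ltnn eqxx /valley; case: ifP => _ //; case: ifP.
case: (ltngtP i x) => [ix|xi|/val_inj//].
- have i1n : (i.+1 < n)%N by exact: leq_ltn_trans ix (ltn_ord x).
  have := imin (Ordinal i1n); rewrite /Defs.adjacent eqxx => /(_ isT).
  rewrite /valley ix /=; case: ifP => [_|/negbT i1lx]; first by rewrite ler_nat; lia.
  case: ifP => [_|/negbT]; first by rewrite lern0; lia.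
  rewrite -(inj_eq val_inj) /= => i1x.
  by rewrite ler_nat; move: (ltn_ord x); lia.
- have i1n : (i.-1 < n)%N by exact: leq_ltn_trans (leq_pred _) (ltn_ord i).
  have := imin (Ordinal i1n); rewrite /Defs.adjacent /= prednK ?eqxx ?orbT; last by lia.
  move=> /(_ isT); rewrite /valley /= ltnNge (ltnW xi) /=.
  rewrite -(inj_eq val_inj) gtn_eqF//= ltnNge.
  have -> /= : (x <= i.-1)%N by lia.
  by case: ifP => _; rewrite ?lern0 ?ler_nat; lia.
Qed.

(* Twice the number of points of Q below x, plus one if x is in Q: this number
   identifies the answers of [valley x] on Q. *)
Definition gap (n : nat) (Q : {set 'I_n}) (x : 'I_n) : nat :=
  (#|[set i in Q | (i < x)%N]| + #|[set i in Q | (i <= x)%N]|)%N.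

Lemma gap_bound (n : nat) (Q : {set 'I_n}) (x : 'I_n) :
  (gap n Q x < (2 * #|Q|).+1)%N.
Proof.
rewrite ltnS mul2n -addnn leq_add// subset_leq_card//;
by apply/fintype.subsetP => i; rewrite inE => /andP[].
Qed.

(** Both counts in [gap] grow with [x], so equal sums force equal counts and, by inclusion, equal
    sets; membership of [i] in them decides [i < x] and [i <= x]. *)
Lemma eq_gap_valley (R : realType) (n : nat) (Q : {set 'I_n}) (x y i : 'I_n) :
  gap n Q x = gap n Q y -> i \in Q -> valley R n x i = valley R n y i.
Proof.
wlog xy : x y / (x <= y)%N.
  move=> H gxy iQ; have [xy|/ltnW yx] := leqP x y; first exact: H.
  by apply/esym/H.
move=> gxy iQ.
have sub1 : [set i in Q | (i < x)%N] \subset [set i in Q | (i < y)%N].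
  by apply/fintype.subsetP => j; rewrite !inE => /andP[-> /leq_trans->].
have sub2 : [set i in Q | (i <= x)%N] \subset [set i in Q | (i <= y)%N].
  by apply/fintype.subsetP => j; rewrite !inE => /andP[-> /leq_trans->].
have c1 := subset_leq_card sub1; have c2 := subset_leq_card sub2.
move: gxy; rewrite /gap => gxy.
have /eqP/setP/(_ i) : [set i in Q | (i < x)%N] == [set i in Q | (i < y)%N].
  by rewrite eqEcard sub1 /= -(leq_add2r #|[set i in Q | (i <= x)%N]|) gxy leq_add2l.
have /eqP/setP/(_ i) : [set i in Q | (i <= x)%N] == [set i in Q | (i <= y)%N].
  by rewrite eqEcard sub2 /= -(leq_add2l #|[set i in Q | (i < x)%N]|) gxy leq_add2r.
rewrite !inE iQ /= => le lt; rewrite /valley lt; case: ifP => // /negbT iy.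
by rewrite -!(inj_eq val_inj)/= !eqn_leq le -!(leqNgt) in iy lt *;
  rewrite [(x <= i)%N]leqNgt lt [(y <= i)%N]leqNgt.
Qed.

(** * Counting bound for deterministic algorithms *)

(** Candidates with the same [gap] give the same answers in the first round and continue in one
    subtree, so the induction hypothesis applies to each such class; this is why [C] is
    arbitrary. *)
Lemma card_found_le (R : realType) (n k : nat) (A : algorithm R n k) (M : R)
    (C : {set 'I_n}) : 1 <= 2 * M ->
  #|[set x in C | output A (valley R n x) == x]|%:R <=
  (2 * M) ^+ k + (\sum_(x in C) queries A (valley R n x))%:R / M.
Proof.
move=> M1; have M0 : 0 < M by lra.
elim: A C => {k} [k i|k Q next IH] C.
  apply: (@le_trans _ _ 1); last first.
    by rewrite (le_trans (exprn_ege1 k M1))// lerDl divr_ge0// ltW.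
  rewrite lern1 -(cards1 i) subset_leq_card//.
  by apply/fintype.subsetP => x; rewrite !inE /= eq_sym => /andP[].
pose b := (2 * M) ^+ k; have b0 : 0 <= b by rewrite exprn_ge0 //; lra.
have b1 : 1 <= b by exact: exprn_ege1.
pose T := (\sum_(x in C) queries (next (fun i => valley R n x (val i)))
  (valley R n x))%N.
have -> : (\sum_(x in C) queries (Round next) (valley R n x))%N =
    (#|C| * #|Q| + T)%N.
  by rewrite /= big_split /= sum_nat_const.
set S := [set _ in _ | _].
have SC : (#|S| <= #|C|)%N.
  by apply/subset_leq_card/fintype.subsetP => x; rewrite inE => /andP[].
have key : #|S|%:R <= (2 * #|Q|).+1%:R * b + T%:R / M.
  pose cls x : 'I_((2 * #|Q|).+1) := Ordinal (gap_bound n Q x).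
  have -> : #|S| = (\sum_j #|[set x in [set x in C | cls x == j] |
      output (Round next) (valley R n x) == x]|)%N.
    rewrite -sum1_card (partition_big cls xpredT)//=.
    apply: eq_bigr => j _; rewrite -[RHS]sum1_card; apply: eq_bigl => x.
    by rewrite !inE andbAC.
  have -> : T = (\sum_j \sum_(x in [set x in C | cls x == j])
      queries (next (fun i => valley R n x (val i))) (valley R n x))%N.
    rewrite /T (partition_big cls xpredT)//=.
    by apply: eq_bigr => j _; apply: eq_bigl => x; rewrite inE.
  rewrite !natr_sum mulr_suml -[X in X%:R * b](card_ord) mulr_natl -sumr_const.
  rewrite -big_split /=; apply: ler_sum => j _.
  (* The subtree of a class is read off a representative [y]; an empty class has none, but
     contributes 0 on the left. *)
  have [[y]|C0] := pselect (exists y, y \in [set x in C | cls x == j]); last first.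
    rewrite (_ : [set x in C | cls x == j] = finset.set0); last first.
      by apply/setP => x; rewrite [RHS]inE; apply/negP => xC; apply: C0; exists x.
    rewrite big_set0 mul0r addr0 (_ : [set x in _ | _] = finset.set0) ?cards0//.
    by apply/setP => x; rewrite !inE.
  rewrite inE => /andP[_ /eqP yj].
  have E x : x \in [set x in C | cls x == j] ->
      (fun i : {i : 'I_n | i \in Q} => valley R n x (val i)) =
      (fun i => valley R n y (val i)).
    rewrite inE => /andP[_ /eqP xj]; apply/funext => -[i iQ] /=.
    by apply: eq_gap_valley iQ; have := congr1 val (etrans xj (esym yj)).
  rewrite (eq_bigr (fun x =>
      queries (next (fun i => valley R n y (val i))) (valley R n x))); last first.
    by move=> x /E ->.
  apply: le_trans (IH _ _); rewrite ler_nat subset_leq_card//.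
  apply/fintype.subsetP => x; rewrite [in X in X -> _]inE => /andP[xC].
  by rewrite inE xC /= E.
(* If C is large, the queries of this round alone pay for the 2 #|Q| additional
   classes; if it is small, the bound exceeds the size of C. *)
have [CM|CM] := leP (2 * M * b) #|C|%:R; last first.
  rewrite exprS -/b; apply: (@le_trans _ _ #|C|%:R); first by rewrite ler_nat.
  by rewrite (le_trans (ltW CM))// lerDl divr_ge0// ltW.
apply: le_trans key _; rewrite exprS -/b -[in leLHS]natr1 !natrD !natrM [in leRHS]mulrDl.
have h1 : b <= 2 * M * b by rewrite ler_peMl.
have h2 : 2 * #|Q|%:R * b <= #|C|%:R * #|Q|%:R / M.
  by rewrite ler_pdivlMr//; have := ler_wpM2r (ler0n R #|Q|) CM; lra.
by lra.
Qed.

(** * The search algorithm for the upper bound *)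

(* The default p is only returned when p is not in Q. *)
Definition lowest (R : realType) (n : nat) (Q : {set 'I_n}) (p : 'I_n)
    (a : {i : 'I_n | i \in Q} -> R) : 'I_n :=
  if insub p is Some p0 then val [arg min_(i < p0) a i]%O else p.

(** The distance bound is split into two additive inequalities, since subtraction on [nat]
    truncates. *)
Definition probes (n m j : nat) (p : 'I_n) : {set 'I_n} :=
  [set i : 'I_n | [&& (i < p + m ^ j.+1)%N, (p < i + m ^ j.+1)%N
                    & (i == p %[mod m ^ j])%N]].

Fixpoint search (R : realType) (n m j : nat) (p : 'I_n) : algorithm R n j :=
  match j with
  | 0 => Output R 0 p
  | j'.+1 => Round (fun a : {i : 'I_n | i \in probes n m j' p} -> R =>
               search R n m j' (lowest R n (probes n m j' p) p a))
  end.

Lemma lowestP (R : realType) (n : nat) (Q : {set 'I_n}) (p : 'I_n)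
    (f : 'I_n -> R) (q := lowest R n Q p (fun i => f (val i))) :
  p \in Q -> q \in Q /\ {in Q, forall i, f q <= f i}.
Proof.
move=> pQ; rewrite /q /lowest insubT; split; first exact: valP.
case: Order.TotalTheory.arg_minP => //= -[i iQ] _ imin j jQ.
exact: (imin (exist _ j jQ)).
Qed.

Lemma probes_self (n m j : nat) (p : 'I_n) : (0 < m)%N -> p \in probes n m j p.
Proof.
by move=> m0; rewrite inE eqxx andbT; have := expn_gt0 m j.+1; lia.
Qed.

Lemma card_probes (n m j : nat) (p : 'I_n) :
  (0 < m)%N -> (#|probes n m j p| <= 2 * m)%N.
Proof.
move=> m0; have d0 : (0 < m ^ j)%N by rewrite expn_gt0 m0.
(* Number of steps of length [m ^ j] from the left end [p - m ^ j.+1] of the window to [i]; this end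
   may be negative. *)
pose s (i : 'I_n) := ((i + m ^ j.+1 - p) %/ m ^ j)%N.
have sE i : i \in probes n m j p -> (i + m ^ j.+1 = p + s i * m ^ j)%N.
  rewrite inE => /and3P[ip pi /eqP imod]; rewrite /s.
  suff /divnK -> : (m ^ j %| i + m ^ j.+1 - p)%N by lia.
  rewrite -eqn_mod_dvd; last by lia.
  by rewrite expnS addnC modnMDl imod.
have sb i : i \in probes n m j p -> (s i < 2 * m)%N.
  move=> iP; have := sE _ iP; move: iP; rewrite inE => /and3P[ip pi _].
  rewrite expnS in ip *; rewrite -(ltn_pmul2r d0); lia.
(* The default 0 is never taken on probes, by [sb]. *)
pose t (i : 'I_n) : 'I_(2 * m) := insubd (Ordinal (n:=2 * m) (m:=0) ltac:(lia)) (s i).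
rewrite -(card_in_imset (f := t)).
  by rewrite -[X in (_ <= X)%N]card_ord max_card.
move=> x y xP yP /(congr1 val); rewrite !val_insubd !sb// => sxy.
by apply/val_inj => /=; have := sE _ xP; have := sE _ yP; rewrite sxy; lia.
Qed.

Lemma queries_search (R : realType) (n m j : nat) (p : 'I_n) (f : 'I_n -> R) :
  (0 < m)%N -> (queries (search R n m j p) f <= j * (2 * m))%N.
Proof.
move=> m0; elim: j p => [//|j IH] p /=.
by rewrite mulSn leq_add// card_probes.
Qed.

(** At [j = 0] the invariant is local minimality itself. Points outside the grid impose no
    condition. *)
Lemma search_local_min (R : realType) (n m j : nat) (p : 'I_n) (f : 'I_n -> R) :
  (0 < m)%N ->
  (forall i : 'I_n, (i == p + m ^ j :> nat)%N || (p == i + m ^ j :> nat)%N ->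
    f p <= f i) ->
  local_min f (output (search R n m j p) f).
Proof.
move=> m0; elim: j p => [|j IH] p pmin /=.
  move=> i; rewrite /Defs.adjacent => pi; apply: pmin.
  by rewrite expn0 !addn1; case/orP: pi => /eqP ->; rewrite eqxx ?orbT.
apply: IH; set Q := probes n m j p.
have [qQ qmin] := lowestP R n Q p f (probes_self n m j p m0).
set q := lowest _ _ _ _ _ in qQ qmin *; move=> i iq.
have [/qmin//|iQ] := boolP (i \in Q).
(* An unprobed neighbour of q lies on the boundary of the previous window, where
   the invariant for p applies. *)
have pq : f q <= f p by apply/qmin/probes_self.
apply: (le_trans pq); apply: pmin.
have D : (m ^ j %| m ^ j.+1)%N by rewrite dvdn_exp2l.
move: qQ iQ; rewrite !inE => /and3P[qp1 qp2 qmod].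
have imod : (i == p %[mod m ^ j])%N.
  by case/orP: iq => /eqP E; move: qmod; rewrite E modnDr.
rewrite imod andbT.
(* Distinct congruent numbers are at least the modulus apart, so a step of [m ^ j] from [q] can
   reach the boundary of the window but not pass it. *)
have aux (a b c : nat) : (a == b %[mod c])%N -> (a < b)%N -> (a + c <= b)%N.
  move=> ab ltab; rewrite -leq_subRL; last exact: ltnW.
  apply: dvdn_leq; first by rewrite subn_gt0.
  by rewrite -eqn_mod_dvd 1?eq_sym// ltnW.
have qmod' : (q == p + m ^ j.+1 %[mod m ^ j])%N.
  by move/dvdnP: D => [c ->]; rewrite addnC modnMDl.
have pmod' : (p == q + m ^ j.+1 %[mod m ^ j])%N.
  by move/dvdnP: D => [c ->]; rewrite addnC modnMDl eq_sym.
have h1 := aux _ _ _ qmod' qp1; have h2 := aux _ _ _ pmod' qp2.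
have d0 : (0 < m ^ j)%N by rewrite expn_gt0 m0.
case/orP: iq => /eqP E; rewrite negb_and -!leqNgt.
- case/orP => h; apply/orP; left.
    by rewrite eqn_leq h andbT E.
  by move: E h h2 d0; clear; lia.
- case/orP => h; apply/orP; right.
    by move: E h h1 d0; clear; lia.
  by rewrite eqn_leq h andbT -(leq_add2r (m ^ j)) addnAC -E.
Qed.

(** * Averaging over the coins *)

Lemma measurable_fun_natr (R : realType) (d : measure_display)
    (T : measurableType d) (g : T -> nat) :
  (forall q, measurable [set w | g w = q]) ->
  measurable_fun setT (fun w => (g w)%:R : R).
Proof.
move=> mg; apply: (@measurableT_comp _ _ _ _ _ _ (fun q : nat => q%:R : R) _ g) => //.
move=> _ Y _; rewrite setTI.
rewrite (_ : g @^-1` Y = \bigcup_(q in Y) [set w | g w = q]).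
  by apply: bigcup_measurable => q _; exact: mg.
by apply/seteqP; split=> [w Yw|w [q Yq /= ->]//]; exists (g w).
Qed.

(** Integrating [card_found_le] for the whole grid over the coins gives [2n/3 <= n/2 + n c / M],
    where [c] is the cost. *)
Lemma rand_cost_ge (R : realType) (n k : nat) (A : rand_algorithm R n k) (M : R) :
  (0 < n)%N -> 1 <= 2 * M -> (2 * M) ^+ k <= n%:R / 2 -> rand_correct A ->
  ((M / 6)%:E <= rand_cost A)%E.
Proof.
move=> n0 M1 bM Acorrect; have M0 : 0 < M by lra.
have cost x : ('E_(coin_law A)[fun w => (queries (run A w) (valley R n x))%:R]
    <= rand_cost A)%E by apply: ereal_sup_ubound; exists (valley R n x).
have cost0 : (0 <= rand_cost A)%E.
  apply: le_trans (cost (Ordinal n0)); apply: expectation_ge0 => w.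
  by rewrite ler0n.
(* Cost [+oo] satisfies the bound trivially; [-oo] contradicts nonnegativity. *)
move: cost cost0; case: (rand_cost A) => [c| |]; last 2 first.
- by move=> _ _; exact: leey.
- by move=> _; rewrite leeNy_eq.
move=> cost c0.
pose E x := [set w | output (run A w) (valley R n x) = x].
have mE x : measurable (E x) by exact: measurable_output.
have PE x : ((2 / 3 : R)%:E <= coin_law A (E x))%E.
  rewrite (_ : E x = [set w | local_min (valley R n x)
                              (output (run A w) (valley R n x))]).
    exact: Acorrect.
  by apply/seteqP; split=> w /(local_min_valley R n x).
pose g x w : \bar R := (queries (run A w) (valley R n x))%:R%:E.
have mg x : measurable_fun setT (g x).
  apply/measurable_EFinP; apply: measurable_fun_natr => q.
  exact: measurable_queries.
have g0 x w : (0 <= g x w)%E by rewrite lee_fin ler0n.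
have : (\int[coin_law A]_w (\sum_x (\1_(E x) w)%:E)%R <=
        \int[coin_law A]_w (((2 * M) ^+ k)%:E + (M^-1)%:E * (\sum_x g x w)%R))%E.
  apply: ge0_le_integral => //.
  - by move=> w _; apply: sume_ge0 => x _; rewrite lee_fin.
  - apply: emeasurable_sum => x; apply/measurable_EFinP.
    exact: measurable_indic.
  - apply: emeasurable_funD => //; apply: emeasurable_funM => //.
    exact: emeasurable_sum.
  move=> w _; rewrite !sumEFin -EFinM -EFinD lee_fin.
  have := card_found_le R n k (run A w) M finset.setT M1.
  rewrite [X in _ <= _ + X / _]natr_sum [X in _ <= _ + X]mulrC.
  under eq_bigl do rewrite finset.in_setT.
  apply: le_trans; rewrite -sum1_card natr_sum [leRHS]big_mkcond /=.
  apply: ler_sum => x _; rewrite !inE /= indicE.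
  case: ifPn => [_|/eqP xw]; first by rewrite lern1 leq_b1.
  by rewrite memNset.
rewrite ge0_integral_sum//; last first.
  by move=> x; apply/measurable_EFinP; exact: measurable_indic.
rewrite ge0_integralD//; last 3 first.
- by move=> w _; rewrite lee_fin exprn_ge0//; lra.
- by move=> w _; rewrite mule_ge0 ?sume_ge0// lee_fin invr_ge0 ltW.
- by apply: emeasurable_funM => //; exact: emeasurable_sum.
rewrite integral_cst//= [X in (_ * X + _)%E](_ : _ = 1%E); last first.
  exact: probability_setT.
rewrite mule1.
rewrite ge0_integralZl_EFin//; last 3 first.
- by move=> w _; exact: sume_ge0.
- exact: emeasurable_sum.
- by rewrite invr_ge0 ltW.
rewrite ge0_integral_sum// => main.
have up : (\sum_x \int[coin_law A]_w g x w <= (n%:R * c)%:E)%E.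
  rewrite (_ : (n%:R * c)%:E = \sum_(x < n) c%:E)%E; last first.
    by rewrite sumEFin sumr_const card_ord mulr_natl.
  by apply: lee_sum => x _; have := cost x; rewrite unlock.
have lo : ((n%:R * (2 / 3))%:E <= \sum_(x < n) \int[coin_law A]_w (\1_(E x) w)%:E)%E.
  rewrite (_ : (n%:R * (2 / 3))%:E = \sum_(x < n) (2 / 3 : R)%:E)%E; last first.
    by rewrite sumEFin sumr_const card_ord mulr_natl.
  by apply: lee_sum => x _; rewrite integral_indic// setIT; exact: PE.
have := le_trans lo (le_trans main (leeD2l _ (lee_wpmul2l _ up))).
rewrite lee_fin invr_ge0 ltW// => /(_ isT).
rewrite -EFinM -EFinD !lee_fin => fin.
have n0' : 0 < n%:R :> R by rewrite ltr0n.
have : n%:R * (6^-1) <= n%:R * (M^-1 * c) by lra.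
rewrite ler_pM2l// ler_pdivlMl//; lra.
Qed.

(** * Comparison of the two complexities and asymptotics *)

(** The coins come from a one-point space. *)
Lemma derandomized_cost (R : realType) (n k : nat) (A : algorithm R n k) :
  det_correct A ->
  exists2 B : rand_algorithm R n k, rand_correct B & (rand_cost B <= det_cost A)%E.
Proof.
move=> Acorrect.
pose B := @RandAlgorithm R n k _ unit (dirac tt) (fun=> A)
  (fun _ _ => I) (fun _ _ => I).
exists B.
  move=> f; rewrite /= (_ : [set _ | _] = setT); last first.
    by apply/seteqP; split=> // w _; exact: Acorrect.
  by rewrite probability_setT lee_fin; lra.
apply: ge_ereal_sup => _ [f _ <-]; rewrite expectation_cst.
by apply: ereal_sup_ubound; exists f.
Qed.

(** From the starting point 0, a step of [m ^ k] leaves the grid in either direction, so the initial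
    invariant is vacuous. *)
Lemma search_correct (R : realType) (n m k : nat) (n0 : (0 < n)%N) :
  (0 < m)%N -> (n <= m ^ k)%N -> det_correct (search R n m k (Ordinal n0)).
Proof.
move=> m0 nm f; apply: search_local_min => // i /=; rewrite add0n => /orP[] /eqP E.
  by have := ltn_ord i; rewrite E ltnNge nm.
by have := expn_gt0 m k; rewrite m0; lia.
Qed.

Lemma query_complexity_bounds (R : realType) (k n : nat)
    (r := n%:R `^ k%:R^-1 : R) :
  (0 < k)%N -> (2 ^ k <= n)%N ->
  [/\ 24^-1 * r <= rand_query_complexity R k n,
      rand_query_complexity R k n <= det_query_complexity R k n
    & det_query_complexity R k n <= (4 * k)%:R * r].
Proof.
move=> k0 kn; have n0 : (0 < n)%N by rewrite (leq_trans _ kn)// expn_gt0.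
have r0 : 0 <= r by exact: powR_ge0.
have rk : r ^+ k = n%:R.
  by rewrite -powR_mulrn// -powRrM mulVf ?powRr1// pnatr_eq0 -lt0n.
(* This serves both bounds: [r + 1 <= 2 * r] for the choice of [m], and [1 <= 2 * M] for
   [M = r / 4]. *)
have r2 : 2 <= r by rewrite -(ler_pXn2r k0)// ?nnegrE// rk -natrX ler_nat.
pose m := (Num.truncn r).+1.
have rm : r < m%:R by exact: truncnS_gt.
have mr : m%:R <= 2 * r.
  have : (Num.truncn r)%:R <= r by rewrite truncn_le.
  by rewrite /m -natr1; lra.
have nm : (n <= m ^ k)%N.
  by rewrite -(ler_nat R) natrX -rk ler_pXn2r// ?nnegrE// ltW.
have Scorrect := search_correct R n m k n0 (ltn0Sn _) nm.
set di := ereal_inf [set c | exists2 A : algorithm R n k,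
  det_correct A & c = det_cost A].
set ri := ereal_inf [set c | exists2 A : rand_algorithm R n k,
  rand_correct A & c = rand_cost A].
have dub : (di <= ((4 * k)%:R * r)%:E)%E.
  apply: (@le_trans _ _ (det_cost (search R n m k (Ordinal n0)))).
    by apply: ereal_inf_lbound; exists (search R n m k (Ordinal n0)).
  apply: ge_ereal_sup => _ [f _ <-]; rewrite lee_fin.
  apply: (@le_trans _ _ (k * (2 * m))%:R); first by rewrite ler_nat queries_search.
  rewrite !natrM; have := ler_wpM2l (ler0n R k) mr; lra.
have rd : (ri <= di)%E.
  apply: le_ereal_inf_tmp => _ [A /derandomized_cost[B Bcorrect BA] ->].
  by apply: le_trans BA; apply: ereal_inf_lbound; exists B.
have rlb : ((24^-1 * r)%:E <= ri)%E.
  apply: le_ereal_inf_tmp => _ [A Acorrect ->].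
  rewrite (_ : 24^-1 * r = r / 4 / 6); last by field.
  apply: rand_cost_ge => //; first by lra.
  (* [(r / 2) ^+ k] is [n / 2 ^ k], at most [n / 2] because [k] is positive. *)
  rewrite (_ : 2 * (r / 4) = r / 2); last by field.
  rewrite expr_div_n rk ler_wpM2l// lef_pV2 ?posrE ?exprn_gt0//.
  by rewrite -[leLHS]expr1 ler_eXn2l// ltr1n.
(* Finiteness of both infima ensures that [fine] preserves the inequalities. *)
have rfin : ri \is a fin_num.
  by rewrite fin_numE -ltNye -ltey (lt_le_trans _ rlb) ?ltNyr//
    (le_lt_trans rd)// (le_lt_trans dub) ?ltry.
have dfin : di \is a fin_num.
  by rewrite fin_numE -ltNye -ltey (lt_le_trans _ (le_trans rlb rd)) ?ltNyr//
    (le_lt_trans dub) ?ltry.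
split; rewrite /rand_query_complexity /det_query_complexity -/di -/ri.
- by rewrite -lee_fin fineK.
- exact: fine_le.
- by rewrite -lee_fin fineK.
Qed.

Lemma eqTheta_bounds (R : realType) (q r : nat -> R) (a b : R) (N : nat) :
  0 < a -> 0 < b -> (forall n, 0 <= r n) ->
  (forall n, (N <= n)%N -> a * r n <= q n /\ q n <= b * r n) ->
  q =Theta_\oo r.
Proof.
move=> a0 b0 r0 H; rewrite eqThetaE qualifE; apply/asboolP.
exists (a, b) => /=; first by rewrite a0.
exists N => // n /= Nn; have [lo hi] := H n Nn.
by rewrite (ger0_norm (r0 n)) ger0_norm// (le_trans _ lo)// mulr_ge0// ltW.
Qed.

Theorem theorem7 (R : realType) (k : nat) (hk : (0 < k)%N) :
  det_query_complexity R k =Theta_\oo (fun n : nat => n%:R `^ k%:R^-1) /\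
  rand_query_complexity R k =Theta_\oo (fun n : nat => n%:R `^ k%:R^-1).
Proof.
have C0 : 0 < (4 * k)%:R :> R by rewrite ltr0n muln_gt0.
have r0 n : 0 <= n%:R `^ k%:R^-1 :> R by exact: powR_ge0.
(* The deterministic lower bound and the randomized upper bound both follow through [rd]. *)
split; apply: (@eqTheta_bounds R _ _ 24^-1 (4 * k)%:R (2 ^ k)%N) => // n kn;
  have [lo rd hi] := query_complexity_bounds R k n hk kn; split=> //.
- exact: le_trans rd.
- exact: le_trans hi.
Qed.
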